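(* Let $g(r) = o(r^{-c})$ as $r\to\infty$ for some $c>d$. Let $\gamma>0$ and let $\hat r_n = \hat r_n(\gamma)$ be defined by $\hat r_n^d = \frac{\gamma\log n}{\alpha n}$. For $a \ge 0$ let $G(a) = \int_{B(O,a)^c} g(|z|)\,dz$. Let $\beta\in\mathbb{R}$, let $\{a_n\}$ be a sequence (of non-negative reals) such that $n\hat r_n^d\, G(a_n) \to e^{-\beta}$ as $n\to\infty$, and set $\bar r_n = a_n\hat r_n$. Let $L_n^o$ be the length of the longest edge incident on the origin in the graph $G_n(\hat r_n)$ under the Palm measure $P^o$. Then $$P^o\left(L_n^o \le \bar r_n\right) \to e^{-e^{-\beta}} \quad\text{as } n\to\infty.$$
   Context: Let $d \ge 2$ and $S = \left(-\frac12,\frac12\right]^d$, equipped with the toroidal metric $d(x,y) = \inf\{|x-y-z| : z \in \mathbb{Z}^d\}$, where $|\cdot|$ is the Euclidean norm. (The letter $d$ denotes the dimension; $d(\cdot,\cdot)$ denotes the metric.) $O$ is the origin and $B(x,r)$ is the Euclidean ball of radius $r$ centered at $x$ in $\mathbb{R}^d$; complements are taken in $\mathbb{R}^d$. The connection function $g:[0,\infty)\to[0,1]$ is non-increasing with $0 < \alpha := \int_{\mathbb{R}^d} g(|x|)\,dx < \infty$. $\mathcal{P}_n$ is a Poisson point process of intensity $n$ on $S$. For $r>0$, $G_n(r)$ is the (undirected) random graph with vertex set $\mathcal{P}_n$ in which, given the points, each pair of distinct vertices $X,Y$ is joined by an edge with probability $g\left(\frac{d(X,Y)}{r}\right)$,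 independently of all other pairs. $P^o$ is the Palm distribution of $\mathcal{P}_n$ conditioned on a point being located at the origin: under $P^o$ the vertex set is distributed as $\mathcal{P}_n\cup\{O\}$ under $P$, with edges formed by the same rule. Edge lengths are measured in the toroidal metric; the length of the longest edge is taken to be $0$ if there is no edge. *)

(* Defs.v *)
From HB Require Import structures.
From mathcomp Require Import all_boot all_order all_algebra.
From mathcomp Require Import all_classical all_reals all_analysis.

Set Implicit Arguments.
Unset Strict Implicit.
Unset Printing Implicit Defensive.

Import Order.TTheory GRing.Theory Num.Theory.
Import numFieldNormedType.Exports.

Local Open Scope classical_set_scope.
Local Open Scope ring_scope.

(* Allows [f =o_+oo g]. *)
Canonical pinfty_nbhs_filter_on (R : realType) :=
  FilterType (pinfty_nbhs R) _.

(* R^d, with its product (= Borel) sigma-algebra. [measurableTypeR R] is [R]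
   with the sigma-algebra that [lebesgue_measure] is defined on. *)
Notation vec R d := (d.-tuple (measurableTypeR R)).

Section lebesgue_cons.
Context {R : realType} (n : nat).
Variable mu : {sigma_finite_measure set (vec R n) -> \bar R}.

Definition cons_pair (xy : measurableTypeR R * vec R n) : vec R n.+1 :=
  [the vec R n.+1 of xy.1 :: xy.2].

Lemma measurable_cons_pair : measurable_fun [set: measurableTypeR R * vec R n] cons_pair.
Proof. exact: measurable_cons. Qed.

Definition lebesgue_cons : set (vec R n.+1) -> \bar R :=
  pushforward (lebesgue_measure \x mu)%E cons_pair.

Let lebesgue_cons0 : lebesgue_cons set0 = 0%E.
Proof. by rewrite /lebesgue_cons /pushforward preimage_set0 measure0. Qed.

Let lebesgue_cons_ge0 A : (0 <= lebesgue_cons A)%E.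
Proof. by rewrite /lebesgue_cons /pushforward; exact: measure_ge0. Qed.

Let lebesgue_cons_sigma_additive : semi_sigma_additive lebesgue_cons.
Proof.
move=> F mF tF mUF; rewrite /lebesgue_cons /pushforward preimage_bigcup.
apply: measure_semi_sigma_additive.
- by move=> i; rewrite -[X in measurable X]setTI; exact: measurable_cons_pair.
- apply/trivIsetP => /= i j _ _ ij; rewrite -preimage_setI.
  by move/trivIsetP : tF => /(_ _ _ _ _ ij) ->//; rewrite preimage_set0.
- rewrite -preimage_bigcup -[X in measurable X]setTI.
  exact: measurable_cons_pair.
Qed.

HB.instance Definition _ := isMeasure.Build _ _ _ lebesgue_cons
  lebesgue_cons0 lebesgue_cons_ge0 lebesgue_cons_sigma_additive.

Let lebesgue_cons_sigma_finite : sigma_finite setT lebesgue_cons.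
Proof.
have /sigma_finiteP[F [TF ndF Foo]] := sigma_finiteT (@lebesgue_measure R).
have /sigma_finiteP[G [TG ndG Goo]] := sigma_finiteT mu.
pose hd (x : vec R n.+1) : measurableTypeR R := thead x.
pose tl (x : vec R n.+1) : vec R n := [tuple of behead x].
have mhd : measurable_fun setT hd by exact: measurable_tnth.
have mtl : measurable_fun setT tl by exact: measurable_behead.
exists (fun k => hd @^-1` F k `&` tl @^-1` G k).
  apply/seteqP; split=> // x _.
  have [i _ Fi] : (\bigcup_i F i) (hd x) by rewrite -TF.
  have [j _ Gj] : (\bigcup_i G i) (tl x) by rewrite -TG.
  exists (maxn i j) => //; split.
  - by move/subsetPset: (ndF _ _ (leq_maxl i j)); apply.
  - by move/subsetPset: (ndG _ _ (leq_maxr i j)); apply.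
move=> k; have [mF Fk] := Foo k; have [mG Gk] := Goo k; split.
  apply: measurableI; rewrite -[X in measurable X]setTI.
  - exact: mhd.
  - exact: mtl.
rewrite /lebesgue_cons /pushforward.
have -> : cons_pair @^-1` (hd @^-1` F k `&` tl @^-1` G k) = F k `*` G k.
  have tlK (xy : (measurableTypeR R * vec R n)%type) : tl (cons_pair xy) = xy.2.
    exact: val_inj.
  by apply/seteqP; split=> -[x y] /=; rewrite tlK.
by rewrite product_measure1E// lte_mul_pinfty// ge0_fin_numE.
Qed.

HB.instance Definition _ := Measure_isSigmaFinite.Build _ _ _ lebesgue_cons
  lebesgue_cons_sigma_finite.

End lebesgue_cons.

Fixpoint lebesgue_tuple (R : realType) (n : nat) :
    {sigma_finite_measure set (vec R n) -> \bar R} :=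
  if n is m.+1 then lebesgue_cons (lebesgue_tuple R m)
  else \d_([tuple] : vec R 0).

Section torus.
Context {R : realType} {d : nat}.
Implicit Types (x y : vec R d).

Definition origin : vec R d := nseq_tuple d 0.

Definition enorm x : R := Num.sqrt (\sum_(i < d) (tnth x i : R) ^+ 2).

Definition torus : set (vec R d) :=
  [set x | forall i, - (1 / 2) < (tnth x i : R) <= 1 / 2].

Definition torus_dist x y : R :=
  inf [set enorm [tuple (tnth x i : R) - tnth y i - (tnth z i)%:~R | i < d]
      | z in [set: d.-tuple int]].

End torus.

Section connection_function.
Context {R : realType}.
Implicit Types (g : R -> R).

(* [g] represents a function on [0, +oo[; its values on negative reals are
   irrelevant. *)
Definition connection_function g : Prop :=
  (forall t, 0 <= t -> 0 <= g t <= 1) /\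
  (forall s t, 0 <= s -> s <= t -> g t <= g s).

Definition connection_mass (d : nat) g : \bar R :=
  (\int[lebesgue_tuple R d]_x (g (enorm x))%:E)%E.

Definition connection_tail (d : nat) g (a : R) : \bar R :=
  (\int[lebesgue_tuple R d]_(x in ~` [set x | (enorm x <= a)%R])
     (g (enorm x))%:E)%E.

End connection_function.

Section random_graph.
Context {R : realType} {d : nat} {disp : measure_display}
  {T : measurableType disp} (P : probability T R).

(* A finite point process is given by a measurable enumeration of its points:
   at the outcome [w] the points are [X 0 w], ..., [X (N w).-1 w], and the
   values [X i w] with [N w <= i] carry no meaning. *)

Definition point_count (N : T -> nat) (X : nat -> T -> vec R d)
    (A : set (vec R d)) (w : T) : nat :=
  (\sum_(i < N w) (X i w \in A))%N.

(* The second argument of [poisson_prob] is a dummy; [poisson_prob 0 _] is the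
   Dirac mass at 0. *)
Definition poisson_process (lambda : R) (N : T -> nat)
    (X : nat -> T -> vec R d) : Prop :=
  [/\ measurable_fun [set: T] N,
      forall i, measurable_fun [set: T] (X i),
      forall w i, (i < N w)%N -> torus (X i w),
      forall A, measurable A -> A `<=` torus -> forall U : set nat,
        P (point_count N X A @^-1` U) =
        poisson_prob (lambda * fine (lebesgue_tuple R d A)) 0 U
    & forall (m : nat) (A : 'I_m -> set (vec R d)),
        (forall l, measurable (A l) /\ A l `<=` torus) -> trivIset setT A ->
        forall k : 'I_m -> nat,
        P [set w | forall l, point_count N X (A l) w = k l] =
        (\prod_(l < m) P [set w | point_count N X (A l) w = k l])%E].

Record random_graph := RandomGraph {
  vertex_count : T -> nat ;
  vertex : nat -> T -> vec R d ;
  edge : nat -> nat -> T -> bool (* adjacency of the i-th and j-th vertices *)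
}.

Definition connection_prob (g : R -> R) (r : R) (G : random_graph) (i j : nat)
    (w : T) : R :=
  g (torus_dist (vertex G i w) (vertex G j w) / r).

(* The last clause says that, conditionally on there being k vertices and on
   their positions, the joint law of the k(k-1)/2 edge indicators is the
   product of the Bernoulli laws with parameters [connection_prob]. *)
Definition random_connection (g : R -> R) (r : R) (G : random_graph) : Prop :=
  [/\ forall i j, measurable_fun [set: T] (edge G i j),
      forall i j w, edge G i j w = edge G j i w
    & forall (k : nat) (B : set (k.-tuple (vec R d)))
             (e : 'I_k -> 'I_k -> bool), measurable B ->
        let V := [set w | vertex_count G w = k /\
                          B [tuple vertex G i w | i < k]] in
        P (V `&` [set w | forall i j : 'I_k, (i < j)%N ->
                          edge G i j w = e i j]) =
        (\int[P]_(w in V)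
          (\prod_(i < k) \prod_(j < k | (i < j)%N)
             (if e i j then connection_prob g r G i j w
              else 1 - connection_prob g r G i j w))%:E)%E].

(* The law of the graph of connection radius r on a Poisson process of
   intensity lambda, under the Palm measure at the origin: the origin is the
   vertex of index 0, the points of the Poisson process have indices >= 1. *)
Definition palm_random_connection (lambda : R) (g : R -> R) (r : R)
    (G : random_graph) : Prop :=
  [/\ forall w, (0 < vertex_count G w)%N,
      forall w, vertex G 0 w = origin,
      poisson_process lambda (fun w => (vertex_count G w).-1)
        (fun i => vertex G i.+1)
    & random_connection g r G].

Definition longest_edge (G : random_graph) (i : nat) (w : T) : R :=
  \big[Num.max/0]_(j < vertex_count G w | (j != i :> nat) && edge G i j w)
    torus_dist (vertex G i w) (vertex G j w).

End random_graph.

Arguments random_graph R d {disp} T.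

(* Main.v *)
Require Import Defs.
From HB Require Import structures.
From mathcomp Require Import all_boot all_order all_algebra.
From mathcomp Require Import all_classical all_reals all_analysis.
From mathcomp Require Import measurable_realfun ring lra.

Set Implicit Arguments.
Unset Strict Implicit.
Unset Printing Implicit Defensive.

Import Order.TTheory GRing.Theory Num.Theory.
Import numFieldNormedType.Exports.

Local Open Scope classical_set_scope.
Local Open Scope ring_scope.

(** The longest edge at the origin is at most [s = a_n r], with [r] the
    connection radius, exactly when the origin has no neighbour outside the ball
    of radius [s]. Given the points, the edges at the origin are independent, so
    this has conditional probability [\prod_X (1 - h X)], where [h x] is
    [g (|x| / r)] for [|x| > s] and [0] otherwise (on the torus the toroidal
    distance to the origin is the Euclidean norm). Averaging over the Poisson
    points gives the Laplace functional, so for every [n > 1] the probability is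
    exactly [exp (- n \int_S h)]: the number of neighbours of the origin outside
    the ball is a Poisson variable. It remains to see that the mean [n \int_S h]
    tends to [e^-beta].

    Rescaling space by [r] turns the mean into [n r^d] times the integral of
    [g (|z|)] over the points [|z| > a_n] of [S / r]. This differs from
    [n r^d G (a_n)], which tends to [e^-beta], by at most [n r^d] times the
    integral of [g (|z|)] over [|z| >= 1 / (2 r)]. Since [g (t) <= t^-c] for large
    [t], cutting space into dyadic shells bounds that integral by a multiple of
    [r^(c - d)]. As [n r^d] is of order [log n] and [r^(c - d)] is of order
    [(log n / n)^((c - d) / d)], the boundary effect vanishes.

    The three steps are [prob_longest_edge] (averaging over the edges),
    [poisson_laplace] (averaging over the points) and [intensity_bounds] with
    [connection_tail_power] and [boundary_cvg0] (the mean). The point process is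
    only known through the joint laws of its counts in disjoint sets, so the
    Laplace functional is first computed for functions of finitely many values,
    where the product over the points is a product of powers of independent
    Poisson counts, and then obtained by squeezing [h] between two such functions
    at distance [1 / M]. *)

(** * The Lebesgue measure on tuples *)

Section lebesgue_tuple_theory.
Context {R : realType}.

Lemma integral_lebesgue_cons n (mu : {sigma_finite_measure set (vec R n) -> \bar R})
    (f : vec R n.+1 -> \bar R) :
  measurable_fun setT f -> (forall x, (0 <= f x)%E) ->
  (\int[lebesgue_cons mu]_x f x =
   \int[lebesgue_measure]_t \int[mu]_y f (cons_pair (t, y)))%E.
Proof.
move=> mf f0.
have mc := @measurable_cons_pair R n.
rewrite (@ge0_integral_pushforward _ _ _ _ _ _ mc)//.
rewrite preimage_setT fubini_tonelli1//; first exact: measurableT_comp.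
by move=> x; exact: f0.
Qed.

(** Both sides integrate [f] against measures agreeing on half-open intervals:
    the right one is [r] times the image of the Lebesgue measure under
    multiplication by [r]. *)
Lemma lebesgue_integral_scale (r : R) (f : measurableTypeR R -> \bar R) :
  0 < r -> measurable_fun setT f -> (forall x, (0 <= f x)%E) ->
  (\int[lebesgue_measure]_t f t =
   r%:E * \int[lebesgue_measure]_t f (r * t : R)%R)%E.
Proof.
move=> r0 mf f0.
pose phi : measurableTypeR R -> measurableTypeR R := fun t => r * t.
have mphi : measurable_fun setT phi by exact: mulrl_measurable.
pose pushed : {measure set (measurableTypeR R) -> \bar R} :=
  measure_function_pushforward__canonical__measure_function_Measure
    lebesgue_measure mphi.
pose nu : {measure set (measurableTypeR R) -> \bar R} :=
  mscale (NngNum (ltW r0)) pushed.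
have -> : (\int[lebesgue_measure]_t f t = \int[nu]_t f t)%E.
  apply: eq_measure_integral => /= A mA _.
  apply: lebesgue_measure_unique => // _ [[a b] _ <-].
  rewrite /= /mscale /= /pushforward/=.
  have -> : phi @^-1` [set` `]a, b]] = [set` `]a / r, b / r]].
    apply/seteqP; split => t /=; rewrite !in_itv/= /phi;
    by rewrite ltr_pdivrMr// ler_pdivlMr// mulrC.
  rewrite !lebesgue_measure_itv/= !lte_fin ltr_pM2r ?invr_gt0//.
  case: ifP => _; last by rewrite mule0.
  by rewrite -!EFinD -EFinM -mulrBl mulrC divfK// gt_eqF.
rewrite ge0_integral_mscale// (@ge0_integral_pushforward _ _ _ _ _ _ mphi)//.
Qed.

Definition vscale d (r : R) (x : vec R d) : vec R d :=
  [tuple (r * tnth x i : R) | i < d].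

Lemma measurable_vscale d (r : R) :
  measurable_fun setT (vscale r : vec R d -> vec R d).
Proof.
apply/measurable_fun_tnthP => i.
rewrite (_ : _ \o _ = (fun t : measurableTypeR R => r * t : measurableTypeR R) \o
   (@tnth d (measurableTypeR R) ^~ i)).
  by apply: measurableT_comp; [exact: mulrl_measurable|exact: measurable_tnth].
by apply/funext => x /=; rewrite tnth_mktuple.
Qed.

Lemma lebesgue_tuple_scale d (r : R) (f : vec R d -> \bar R) :
  0 < r -> measurable_fun setT f -> (forall x, (0 <= f x)%E) ->
  (\int[lebesgue_tuple R d]_x f x =
   (r ^+ d)%:E * \int[lebesgue_tuple R d]_x f (vscale r x))%E.
Proof.
move=> r0; elim: d f => [|d IH] f mf f0.
  rewrite /= expr0 mul1e !integral_dirac//.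
    by rewrite !diracT !mul1e (tuple0 (vscale _ _)).
  by apply: measurableT_comp mf _; exact: measurable_vscale.
rewrite /= !integral_lebesgue_cons//; last first.
  by apply: measurableT_comp mf _; exact: measurable_vscale.
transitivity (\int[lebesgue_measure]_t ((r ^+ d)%:E *
   \int[lebesgue_tuple R d]_y f (cons_pair (t, vscale r y))))%E.
  apply: eq_integral => t _; rewrite IH//.
  apply: (measurableT_comp mf).
  exact: (@measurable_cons _ _ _ _ (fun=> t) _ id).
have mFy : measurable_fun setT (fun t : measurableTypeR R =>
    \int[lebesgue_tuple R d]_y f (cons_pair (t, vscale r y)))%E.
  apply: (@measurable_fun_fubini_tonelli_F _ _ _ _ _ _
    (fun ty => f (cons_pair (ty.1, vscale r ty.2)))) => //.
  apply: (measurableT_comp mf).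
  apply: (@measurable_cons _ _ _ _ fst _ (@vscale d r \o snd)) => //.
  by apply: measurableT_comp => //; exact: measurable_vscale.
rewrite ge0_integralZl//; last 2 first.
- by move=> t _; exact: integral_ge0.
- by rewrite lee_fin exprn_ge0// ltW.
rewrite (lebesgue_integral_scale r0 mFy); last by move=> t; exact: integral_ge0.
rewrite muleA -EFinM -exprSr; congr (_ * _)%E.
apply: eq_integral => t _; apply: eq_integral => y _; congr f.
apply: eq_from_tnth => i; rewrite tnth_mktuple.
have [j ->|->] := unliftP ord0 i; last by rewrite !tnth0.
by rewrite !tnthS tnth_mktuple.
Qed.

Definition cube d (I : set (measurableTypeR R)) : set (vec R d) :=
  [set x | forall i, I (tnth x i)].
Arguments cube d I : clear implicits.

Lemma measurable_cube d I : measurable I -> measurable (cube d I).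
Proof.
move=> mI; rewrite (_ : cube d I =
    \bigcap_(i in [set: 'I_d]) ((@tnth d (measurableTypeR R) ^~ i) @^-1` I)).
  apply: fin_bigcap_measurable => // i _; rewrite -[X in measurable X]setTI.
  exact: measurable_tnth.
by apply/seteqP; split => x /= h i; [move=> _|]; exact: h.
Qed.

Lemma lebesgue_cube d I (r : R) : measurable I ->
  lebesgue_measure I = r%:E -> lebesgue_tuple R d (cube d I) = (r ^+ d)%:E.
Proof.
move=> mI Ir; elim: d => [|d IH].
  by rewrite /= diracE/= mem_set// => -[].
rewrite /= /lebesgue_cons /pushforward.
rewrite (_ : _ @^-1` _ = I `*` cube d I).
  rewrite product_measure1E//; last exact: measurable_cube.
  by rewrite exprS EFinM; congr (_ * _)%E.
apply/seteqP; split => -[t x] /=.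
  by move=> h; split; [have := h ord0|move=> i; have := h (lift ord0 i); rewrite tnthS].
move=> [It Ix] i; have [j ->|->] := unliftP ord0 i; last by rewrite tnth0.
by rewrite tnthS; apply: Ix.
Qed.

Lemma measurable_enorm d : measurable_fun setT (enorm : vec R d -> R).
Proof.
apply: (@measurableT_comp _ _ _ _ _ _ (@Num.sqrt R)).
  by apply: continuous_measurable_fun; exact: sqrt_continuous.
apply: measurable_sum => i; apply: measurable_funX; exact: measurable_tnth.
Qed.

End lebesgue_tuple_theory.

Arguments cube {R} d I.

(** * Euclidean norm and toroidal distance *)

Section torus_theory.
Context {R : realType} {d : nat}.
Implicit Types x y : vec R d.

Lemma enorm_ge0 x : 0 <= enorm x.
Proof. exact: sqrtr_ge0. Qed.

Lemma normr_tnth_le_enorm x i : `|tnth x i : R| <= enorm x.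
Proof.
rewrite -sqrtr_sqr /enorm ler_wsqrtr// (bigD1 i)//= lerDl.
by apply: sumr_ge0 => j _; exact: sqr_ge0.
Qed.

Lemma enorm_vscale (r : R) x : 0 <= r -> enorm (vscale r x) = r * enorm x.
Proof.
move=> r0; rewrite /enorm -[in RHS](ger0_norm r0) -sqrtr_sqr -sqrtrM ?sqr_ge0//.
rewrite mulr_sumr; congr Num.sqrt; apply: eq_bigr => i _.
by rewrite tnth_mktuple exprMn.
Qed.

Lemma tnth_origin i : tnth (origin : vec R d) i = 0.
Proof. by rewrite (tnth_nth 0) nth_nseq if_same. Qed.

Lemma torus_dist_ge0 x y : 0 <= torus_dist x y.
Proof.
apply: lb_le_inf; last by move=> _ [z _ <-]; exact: enorm_ge0.
by eexists; exists [tuple 0 | i < d].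
Qed.

(** A coordinate of absolute value at most [1/2] cannot be brought closer to [0]
    by an integer translation, so the null translation attains the infimum. *)
Lemma torus_dist_origin x : torus x -> torus_dist origin x = enorm x.
Proof.
move=> Sx; apply/eqP; rewrite eq_le; apply/andP; split.
  apply: ge_inf; first by exists 0 => _ [z _ <-]; exact: enorm_ge0.
  exists [tuple 0 | i < d] => //; rewrite /enorm; congr Num.sqrt.
  apply: eq_bigr => i _; rewrite !tnth_mktuple.
  by rewrite tnth_origin sub0r subr0 sqrrN.
apply: lb_le_inf; first by eexists; exists [tuple 0 | i < d].
move=> _ [z _ <-]; rewrite ler_wsqrtr//; apply: ler_sum => i _.
rewrite tnth_mktuple tnth_origin sub0r -opprD sqrrN.
rewrite -[leLHS]real_normK ?num_real// -[leRHS]real_normK ?num_real//.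
rewrite ler_sqr ?nnegrE//.
have [->|z0] := eqVneq (tnth z i) 0; first by rewrite addr0.
have /andP[xl xr] := Sx i.
have z1 : 1 <= `|(tnth z i)%:~R : R|.
  by rewrite -intr_norm (ler_int _ 1) -gtz0_ge1 normr_gt0.
have x2 : `|tnth x i : R| <= 1 / 2 by rewrite ler_norml xr (ltW xl).
have := ler_normB (tnth x i + (tnth z i)%:~R : R) (tnth x i : R).
rewrite addrAC subrr add0r; lra.
Qed.

(** After rescaling by [r], the part of space outside the torus is thus outside
    the open ball of radius [1 / (2 r)]. *)
Lemma enorm_torusC x : ~ torus x -> 1 / 2 <= enorm x.
Proof.
move=> /existsNP[i Si]; apply: le_trans (normr_tnth_le_enorm x i).
rewrite leNgt; apply/negP; rewrite ltr_norml => /andP[xl xr].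
by apply: Si; rewrite xl ltW.
Qed.

Lemma torusE : torus = cube d [set` `]- (1 / 2), 1 / 2]] :> set (vec R d).
Proof. by apply/seteqP; split => x h i; have := h i; rewrite /= in_itv. Qed.

Lemma measurable_torus : measurable (torus : set (vec R d)).
Proof. by rewrite torusE; apply: measurable_cube. Qed.

Lemma lebesgue_torus : lebesgue_tuple R d torus = 1%E.
Proof.
rewrite torusE (@lebesgue_cube _ _ _ 1)// ?expr1n//.
rewrite lebesgue_measure_itv/= lte_fin ifT; last by lra.
by rewrite -EFinD; congr EFin; lra.
Qed.

(** The infimum ranges over a countable set, which is listed as a sequence so as
    to appear as a lower envelope of measurable functions. *)
Lemma measurable_torus_dist disp (T : measurableType disp) (X Y : T -> vec R d) :
  measurable_fun setT X -> measurable_fun setT Y ->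
  measurable_fun setT (fun w => torus_dist (X w) (Y w)).
Proof.
move=> mX mY.
pose zk k := odflt [tuple 0 | i < d] (unpickle k : option (d.-tuple int)).
pose h k w := enorm [tuple (tnth (X w) i : R) - tnth (Y w) i
  - (tnth (zk k) i)%:~R | i < d].
have -> : (fun w => torus_dist (X w) (Y w)) = (fun w => infs (h^~ w) 0%N).
  apply/funext => w; congr inf; apply/seteqP; split => _ [z _ <-].
    by exists (pickle z) => //; rewrite /h /zk pickleK.
  by exists (zk z).
apply: measurable_fun_infs.
  by move=> w _; exists 0 => _ [k _ <-]; exact: enorm_ge0.
move=> k; apply: (measurableT_comp (@measurable_enorm R d)).
apply/measurable_fun_tnthP => i.
rewrite (_ : _ \o _ = fun w => (tnth (X w) i : R) - tnth (Y w) i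
  - (tnth (zk k) i)%:~R); last by apply/funext => w /=; rewrite tnth_mktuple.
apply: measurable_funB => //; apply: measurable_funB.
  by apply: (measurableT_comp (@measurable_tnth _ _ d i)).
by apply: (measurableT_comp (@measurable_tnth _ _ d i)).
Qed.

(** Monotonicity on the nonnegative reals is enough: precomposing with the
    positive part gives a function monotone on the whole line. *)
Lemma measurable_connection (g : R -> R) disp (T : measurableType disp) (f : T -> R) :
  connection_function g -> measurable_fun setT f -> (forall w, 0 <= f w) ->
  measurable_fun setT (fun w => g (f w)).
Proof.
move=> [_ gni] mf f0.
pose g0 t := g (Num.max t 0).
rewrite (_ : (fun _ => _) = g0 \o f).
  apply: measurableT_comp mf; apply: nonincreasing_measurable => // s t st.
  apply: gni; first by rewrite le_max lexx orbT.
  by rewrite ge_max le_max st/= le_max lexx orbT.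
by apply/funext => w /=; rewrite /g0 max_l.
Qed.

End torus_theory.

(** * Decay of the tail of the connection function *)

Section tail.
Context {R : realType}.

Lemma enorm_lt_cube d (x : vec R d) s : enorm x < s -> cube d [set` `[- s, s]] x.
Proof.
move=> xs i; rewrite /= in_itv/= -ler_norml.
exact: le_trans (normr_tnth_le_enorm x i) (ltW xs).
Qed.

Lemma measurable_enorm_ge d r : measurable [set x : vec R d | r <= enorm x].
Proof.
rewrite (_ : [set _ | _] = enorm @^-1` `[r, +oo[%classic).
  by rewrite -[X in measurable X]setTI; apply: measurable_enorm.
by apply/seteqP; split=> x; rewrite /= in_itv/= andbT.
Qed.

Lemma measurable_enorm_lt d r : measurable [set x : vec R d | enorm x < r].
Proof.
rewrite (_ : [set _ | _] = enorm @^-1` `]-oo, r[%classic).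
  by rewrite -[X in measurable X]setTI; apply: measurable_enorm.
by apply/seteqP; split=> x; rewrite /= in_itv.
Qed.

Lemma measurable_enorm_gt d r : measurable [set x : vec R d | r < enorm x].
Proof.
rewrite (_ : [set _ | _] = enorm @^-1` `]r, +oo[%classic).
  by rewrite -[X in measurable X]setTI; apply: measurable_enorm.
by apply/seteqP; split=> x; rewrite /= in_itv/= andbT.
Qed.

Lemma measurable_shell d s t : measurable [set x : vec R d | s <= enorm x < t].
Proof.
rewrite (_ : [set _ | _] = [set x | s <= enorm x] `&` [set x | enorm x < t]).
  apply: measurableI; [exact: measurable_enorm_ge|exact: measurable_enorm_lt].
by apply/seteqP; split => x /=; [move=> /andP[]|move=> [-> ->]].
Qed.

(** The shell lies in the cube of side [2 t], and [g] is at most its value at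
    the inner radius. *)
Lemma connection_shell d (g : R -> R) s t : connection_function g ->
  0 < s -> s <= t ->
  (\int[lebesgue_tuple R d]_(x in [set x | (s <= enorm x < t)%R]) (g (enorm x))%:E
   <= (g s * (2 * t) ^+ d)%:E)%E.
Proof.
move=> gc s0 st; have [g01 gni] := gc.
set F := [set x | _].
have mF : measurable F by exact: measurable_shell.
have mg : measurable_fun setT (fun x : vec R d => (g (enorm x))%:E).
  apply/measurable_EFinP; apply: measurable_connection => //.
    exact: measurable_enorm.
  by move=> x; exact: enorm_ge0.
have mt : measurable (cube d [set` `[- t, t]] : set (vec R d)).
  exact: measurable_cube.
have gs0 : 0 <= g s by have /andP[] := g01 _ (ltW s0).
apply: (@le_trans _ _ (\int[lebesgue_tuple R d]_(x in F) (g s)%:E)%E).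
  apply: ge0_le_integral => //.
  - by move=> x /andP[sx _]; rewrite lee_fin; have /andP[] := g01 _ (enorm_ge0 x).
  - exact: measurable_funTS.
  - by move=> x /andP[sx _]; rewrite lee_fin gni// ltW.
rewrite integral_cst// EFinM; apply: lee_wpmul2l; first by rewrite lee_fin.
rewrite -(@lebesgue_cube R d [set` `[- t, t]])//.
  apply: le_measure; rewrite ?inE//.
  by move=> x /andP[_ xt]; exact: enorm_lt_cube.
rewrite lebesgue_measure_itv/= lte_fin ifT; last by rewrite gtrN// (lt_le_trans s0).
by rewrite -EFinD; congr EFin; ring.
Qed.

(** On the shell [2^k rho <= |x| < 2^(k+1) rho] the integrand is at most
    [(2^k rho)^-c] and the volume at most [(4 * 2^k rho)^d]; these bounds form a
    geometric series of ratio [2^(d - c) < 1] and first term [4^d rho^(d - c)]. *)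
Lemma connection_tail_power d (g : R -> R) (c : R) : connection_function g ->
  d%:R < c -> g =o_+oo (fun t : R => t `^ (- c)) ->
  exists2 K : R, 0 <= K & \forall rho \near +oo,
  (\int[lebesgue_tuple R d]_(x in [set x | (rho <= enorm x)%R]) (g (enorm x))%:E
   <= (K * rho `^ (d%:R - c))%:E)%E.
Proof.
move=> gc dc go; have [g01 gni] := gc.
pose q : R := 2 `^ (d%:R - c).
have q0 : 0 < q by rewrite powR_gt0.
have q1 : q < 1.
  rewrite /q /powR gt_eqF// -[ltRHS]expR0 ltr_expR nmulr_rlt0 ?subr_lt0//.
  by rewrite ln_gt0 ?ltr1n.
pose K : R := 4 ^+ d * (1 - q)^-1.
exists K; first by rewrite mulr_ge0// ?exprn_ge0// invr_ge0 subr_ge0 ltW.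
have [M [_ gM]] : \forall t \near +oo, g t <= t `^ (- c).
  move/eqoP : go => /(_ 1 ltr01); apply: filterS => t.
  by rewrite mul1r [X in _ <= X]ger0_norm ?powR_ge0//; apply/le_trans/ler_norm.
near=> rho.
have rho0 : 0 < rho by near: rho; apply: nbhs_pinfty_gt; exact: num_real.
have rhoM : M < rho by near: rho; apply: nbhs_pinfty_gt; exact: num_real.
pose s k : R := 2 ^+ k * rho.
have s0 k : 0 < s k by rewrite mulr_gt0// exprn_gt0.
have sS k : s k <= s k.+1 by rewrite ler_pM2r// exprS ler_peMl ?exprn_ge0 ?ler1n.
have shom m n : (m <= n)%N -> s m <= s n.
  by move=> mn; rewrite ler_pM2r// ler_eXn2l ?ltr1n.
pose F k : set (vec R d) := [set x | s k <= enorm x < s k.+1].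
have mF k : measurable (F k) by exact: measurable_shell.
have -> : [set x | rho <= enorm x] = \bigcup_k F k.
  apply/seteqP; split => x /=; last first.
    move=> [k _ /andP[+ _]]; apply: le_trans.
    by have := shom _ _ (leq0n k); rewrite {1}/s expr0 mul1r.
  move=> rx.
  have ex : exists k, enorm x < s k.
    have [N xN] : exists N, enorm x / rho < N%:R.
      exists (Num.truncn (enorm x / rho)).+1; exact: truncnS_gt.
    exists N; rewrite /s -ltr_pdivrMr//; apply: lt_le_trans xN _.
    by rewrite -natrX ler_nat ltnW// ltn_expl.
  case: (ex_minnP ex) => -[|k] xk kmin.
    by move: xk; rewrite /s expr0 mul1r ltNge rx.
  exists k => //; rewrite /F /= xk andbT leNgt; apply/negP => /kmin.
  by rewrite ltnn.
rewrite ge0_integral_bigcup//; last 3 first.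
- apply: measurable_funTS; apply/measurable_EFinP; apply: measurable_connection => //.
    exact: measurable_enorm.
  by move=> x; exact: enorm_ge0.
- by move=> x _; rewrite lee_fin; have /andP[] := g01 _ (enorm_ge0 x).
- apply/trivIsetP => i j _ _; wlog ij : i j / (i < j)%N.
    move=> h; rewrite neq_ltn => /orP[] ij; first by apply: h; rewrite ?ltn_eqF.
    by rewrite setIC; apply: h; rewrite ?ltn_eqF.
  move=> _; apply/seteqP; split => // x [/andP[_ xi] /andP[xj _]].
  by have := lt_le_trans xi (le_trans (shom _ _ ij) xj); rewrite ltxx.
apply: lime_le.
  apply: is_cvg_nneseries => k _ _; apply: integral_ge0 => x _.
  by rewrite lee_fin; have /andP[] := g01 _ (enorm_ge0 x).
apply: nearW => n.
apply: (@le_trans _ _ (series (geometric (4 ^+ d * rho `^ (d%:R - c)) q) n)%:E); last first.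
  rewrite lee_fin; apply: le_trans (geometric_le_lim _ _ _ _) _ => //.
  - by rewrite mulr_ge0// ?powR_ge0// exprn_ge0.
  - by rewrite gtr0_norm.
  - by rewrite /K -!mulrA ler_pM2l ?exprn_gt0// mulrC.
rewrite /series/= -sumEFin; apply: lee_sum => k _.
apply: le_trans (connection_shell _ _ _ _) _ => //.
rewrite lee_fin.
apply: (@le_trans _ _ (s k `^ (- c) * (4 * s k) ^+ d)).
  rewrite (_ : 2 * s k.+1 = 4 * s k); last by rewrite /s exprS; ring.
  apply: ler_wpM2r; first by rewrite exprn_ge0// mulr_ge0// ltW.
  apply: gM; apply: lt_le_trans rhoM _.
  by have := shom _ _ (leq0n k); rewrite {1}/s expr0 mul1r.
rewrite exprMn -(powR_mulrn _ (ltW (s0 k))) mulrCA -mulrA ler_pM2l ?exprn_gt0//.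
rewrite -powRD; last by rewrite (gt_eqF (s0 k)) implybT.
rewrite [- c + _]addrC /s powRM ?exprn_ge0 ?(ltW rho0)//.
by rewrite mulrC ler_pM2l ?powR_gt0// /q -powR_mulrn// powRAC powR_mulrn ?powR_ge0.
Unshelve. all: by end_near. Qed.

(** Since [ln y < y], taking [y = n^e] gives [ln n <= n^e / e]; the choice
    [e = s / (2 p)] spends only half of the decay [n^-s]. *)
Lemma ln_powR_cvg0 (p s : R) : 0 < p -> 0 < s ->
  ln n%:R `^ p * n%:R `^ (- s) @[n --> \oo] --> (0 : R).
Proof.
move=> p0 s0; pose e := s / (2 * p).
have e0 : 0 < e by rewrite divr_gt0// mulr_gt0.
have lim0 : e^-1 `^ p * (n%:R^-1) `^ (s / 2) @[n --> \oo] --> (0 : R).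
  rewrite -[X in _ --> X](mulr0 (e^-1 `^ p)); apply: cvgMl_tmp.
  apply: (@cvg_comp _ _ _ (fun n => n%:R^-1) (@powR R ^~ (s / 2)) _ 0^'+); last first.
    by apply: powR_cvg0; rewrite divr_gt0.
  move=> A [e' /= e'0 Ae]; near=> n; apply: Ae => /=; last first.
    by rewrite invr_gt0 ltr0n; near: n; exists 1%N.
  rewrite sub0r normrN ger0_norm// invf_plt ?posrE//; last first.
    by rewrite ltr0n; near: n; exists 1%N.
  by near: n; apply: nbhs_infty_gtr.
apply: (squeeze_cvgr _ (cvg_cst 0) lim0).
near=> n.
have n0 : 0 < n%:R :> R by rewrite ltr0n; near: n; exists 1%N.
have n1 : 1 <= n%:R :> R by rewrite ler1n; near: n; exists 1%N.
rewrite mulr_ge0 ?powR_ge0//=.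
have lnle : ln n%:R <= e^-1 * n%:R `^ e :> R.
  rewrite ler_pdivlMl// -ln_powR; apply/ltW/ln_sublinear; exact: powR_gt0.
have : ln n%:R `^ p <= (e^-1 * n%:R `^ e) `^ p.
  apply: ge0_ler_powR => //; first exact: ltW.
    by rewrite nnegrE ln_ge0.
  by rewrite nnegrE mulr_ge0 ?powR_ge0// invr_ge0 ltW.
rewrite powRM ?powR_ge0// ?invr_ge0 ?(ltW e0)// -powRrM => h.
apply: le_trans (ler_wpM2r (powR_ge0 _ _) h) _.
rewrite -mulrA -powRD; last by rewrite (gt_eqF n0) implybT.
rewrite ler_pM2l ?powR_gt0 ?invr_gt0//.
rewrite -(powR_inv1 (ltW n0)) -powRrM (_ : _ - s = -1 * (s / 2))//.
by rewrite /e; field; rewrite gt_eqF.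
Unshelve. all: by end_near. Qed.

End tail.

(** * Random variables with values in the natural numbers *)

Section nat_valued.
Context {R : realType} {disp : measure_display} {T : measurableType disp}.

Lemma measurable_stopped {disp'} {U : measurableType disp'} (N : T -> nat)
    (f : nat -> T -> U) :
  measurable_fun setT N -> (forall n, measurable_fun setT (f n)) ->
  measurable_fun setT (fun w => f (N w) w).
Proof.
move=> mN mf _ Y mY; rewrite setTI.
rewrite (_ : _ @^-1` _ = \bigcup_n (N @^-1` [set n] `&` f n @^-1` Y)).
  apply: bigcup_measurable => n _.
  by apply: measurableI; rewrite -[X in measurable X]setTI; [apply: mN|apply: mf].
apply/seteqP; split => w /=; first by move=> h; exists (N w).
by move=> [n _ [/= ->]].
Qed.

Lemma measurable_nat_fun (f : T -> nat) :
  measurable_fun setT (fun w => (f w)%:R : R) -> measurable_fun setT f.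
Proof.
move=> mf _ Y _; rewrite setTI.
rewrite (_ : _ @^-1` _ = \bigcup_(k in Y) ((fun w => (f w)%:R : R) @^-1` [set k%:R])).
  by apply: bigcup_measurable => k _; rewrite -[X in measurable X]setTI; apply: mf.
apply/seteqP; split => w /=; first by move=> h; exists (f w).
by move=> [k Yk /= /eqP]; rewrite eqr_nat => /eqP ->.
Qed.

Lemma measurable_finite_level (I : finType) (lev : T -> I) (c : I -> R) :
  (forall l, measurable (lev @^-1` [set l])) ->
  measurable_fun setT (fun x => c (lev x)).
Proof.
move=> mlev _ Y _; rewrite setTI.
rewrite (_ : _ @^-1` _ = \bigcup_(l in c @^-1` Y) (lev @^-1` [set l])).
  by apply: fin_bigcup_measurable => //; exact: finite_finset.
apply/seteqP; split => x; first by move=> cY; exists (lev x).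
by move=> [l /= lY xl]; rewrite /preimage/= xl.
Qed.

Lemma integral_fiber (mu : {measure set T -> \bar R}) (K : T -> nat) (D : set T)
    (Z : T -> \bar R) :
  measurable_fun setT K -> measurable D -> measurable_fun D Z ->
  (forall w, D w -> (0 <= Z w)%E) ->
  (\int[mu]_(w in D) Z w =
   \sum_(k <oo) \int[mu]_(w in D `&` K @^-1` [set k]) Z w)%E.
Proof.
move=> mK mD mZ Z0.
have DE : D = \bigcup_k (D `&` K @^-1` [set k]).
  by rewrite -setI_bigcupr -preimage_bigcup -[LHS]setIT; congr (_ `&` _);
    apply/seteqP; split => // w _; exists (K w).
rewrite [in LHS]DE ge0_integral_bigcup -?DE//.
  move=> k; apply: measurableI => //; rewrite -[X in measurable X]setTI.
  exact: mK.
apply/trivIsetP => i j _ _ ij; apply/seteqP; split => // w [[_ /= Ki] [_ /= Kj]].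
by move/eqP: ij; apply; rewrite -Ki -Kj.
Qed.

End nat_valued.

Section independence.
Context {R : realType} {disp : measure_display} {T : measurableType disp}.
Variables (P : probability T R) (m : nat) (K : 'I_m -> T -> nat).
Hypothesis mK : forall l, measurable_fun setT (K l).
Hypothesis indepK : forall k : 'I_m -> nat,
  (P [set w | forall l, K l w = k l] = \prod_(l < m) P [set w | K l w = k l])%E.

(** Independence is given through the joint probabilities of the values. The
    variables are integrated out one at a time: the induction is on the list [s]
    of those already integrated, the others being pinned to the values [k]. *)
Lemma integral_prod_indep (F : 'I_m -> nat -> R) :
  (forall l k, 0 <= F l k <= 1) ->
  (\int[P]_w (\prod_(l < m) F l (K l w))%:E =
   \prod_(l < m) \int[P]_w (F l (K l w))%:E)%E.
Proof.
move=> F01.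
have F0 l k : 0 <= F l k by have /andP[] := F01 l k.
have mKk l k : measurable (K l @^-1` [set k]).
  by rewrite -[X in measurable X]setTI; exact: mK.
pose D (s : seq 'I_m) (k : 'I_m -> nat) : set T :=
  [set w | forall l, l \notin s -> K l w = k l].
have mD s k : measurable (D s k).
  rewrite (_ : D s k = \bigcap_(l in [set l | l \notin s]) (K l @^-1` [set k l])).
    apply: fin_bigcap_measurable; first exact: finite_finset.
    by move=> l _; exact: mKk.
  by apply/seteqP; split => w h l /= ls; exact: h.
have mF l D' : measurable_fun D' (fun w => F l (K l w)).
  apply: measurable_funTS; apply: (measurableT_comp _ (mK l)).
  by move=> _ Y _; rewrite setTI.
have Ffin l : (\int[P]_w (F l (K l w))%:E)%E \is a fin_num.
  rewrite ge0_fin_numE; last by apply: integral_ge0 => w _; rewrite lee_fin.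
  apply: (@le_lt_trans _ _ (\int[P]_w (cst 1%E w))%E); last first.
    by rewrite integral_cst// mul1e [X in (X < _)%E]probability_setT ltry.
  apply: ge0_le_integral => //.
  - by move=> w _; rewrite lee_fin.
  - exact/measurable_EFinP.
  - by move=> w _; rewrite lee_fin; have /andP[] := F01 l (K l w).
have main (s : seq 'I_m) (k : 'I_m -> nat) : uniq s ->
  (\int[P]_(w in D s k) (\prod_(l <- s) F l (K l w))%:E =
   \prod_(l <- s) \int[P]_w (F l (K l w))%:E *
   \prod_(l < m | l \notin s) P [set w | K l w = k l])%E.
  elim: s k => [|j s IH] k.
    move=> _; under eq_integral do rewrite big_nil.
    rewrite integral_cst// mul1e big_nil mul1e -indepK; congr (P _).
    by apply/seteqP; split => w h l; [exact: (h l)|move=> _; exact: h].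
  move=> /= /andP[js us].
  (* Splitting along the value [n] of [K j] pins this variable too, so that the
     induction hypothesis applies. *)
  pose k' n l := if l == j then n else k l.
  rewrite (integral_fiber _ (mK j))//; last 2 first.
  - apply/measurable_EFinP; apply: measurable_prod => l _; exact: mF.
  - by move=> w _; rewrite lee_fin prodr_ge0.
  have DE n : D (j :: s) k `&` K j @^-1` [set n] = D s (k' n).
    apply/seteqP; split => w /=.
      move=> [h Kj] l ls; rewrite /k'; case: eqVneq => [->//|lj].
      by apply: h; rewrite inE negb_or lj.
    move=> h; split; last by have := h _ js; rewrite /k' eqxx.
    by move=> l; rewrite inE negb_or => /andP[lj ls]; rewrite h// /k' (negbTE lj).
  pose c := (\prod_(l <- s) \int[P]_w (F l (K l w))%:E *
     \prod_(l < m | l \notin j :: s) P [set w | K l w = k l])%E.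
  transitivity (\sum_(n <oo) c * ((F j n)%:E * P (K j @^-1` [set n])))%E.
    apply: eq_eseriesr => n _; rewrite DE.
    transitivity (\int[P]_(w in D s (k' n)) ((F j n)%:E *
       (\prod_(l <- s) F l (K l w))%:E))%E.
      apply: eq_integral => w; rewrite inE => h; rewrite big_cons EFinM.
      by have := h _ js; rewrite /k' eqxx => ->.
    rewrite ge0_integralZl//; last 3 first.
    - apply/measurable_EFinP; apply: measurable_prod => l _; exact: mF.
    - by move=> w _; rewrite lee_fin prodr_ge0.
    - by rewrite lee_fin.
    rewrite IH//.
    have -> : (\prod_(l < m | l \notin s) P [set w | K l w = k' n l] =
        P (K j @^-1` [set n]) *
        \prod_(l < m | l \notin j :: s) P [set w | K l w = k l])%E.
      rewrite (bigD1 j)//=; congr (_ * _)%E; first by rewrite /k' eqxx.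
      apply: eq_big => l; first by rewrite inE negb_or andbC.
      by move=> /andP[_ lj]; rewrite /k' (negbTE lj).
    by rewrite /c muleCA -[RHS]muleA; congr (_ * _)%E; rewrite [RHS]muleC muleA.
  have cfin : c \is a fin_num.
    rewrite /c fin_numM//.
      by apply: (big_ind (fun x : \bar R => x \is a fin_num)) => //; exact: fin_numM.
    apply: (big_ind (fun x : \bar R => x \is a fin_num)) => //.
      exact: fin_numM.
    by move=> l _; exact: (fin_num_measure P _ (mKk l (k l))).
  rewrite -(fineK cfin) nneseriesZl; last first.
    by move=> n _; rewrite mule_ge0// ?lee_fin// measure_ge0.
  rewrite fineK// big_cons muleC muleA; congr (_ * _ * _)%E.
  rewrite [RHS](integral_fiber _ (mK j))//; last 2 first.
  - by apply/measurable_EFinP; exact: mF.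
  - by move=> w _; rewrite lee_fin.
  apply: eq_eseriesr => n _; rewrite setTI -integral_cst//.
  by apply: eq_integral => w; rewrite inE => /= ->.
have := main (index_enum 'I_m) (fun=> 0%N) (index_enum_uniq _).
rewrite [X in (_ * X)%E]big1 ?mule1//; last by move=> l; rewrite mem_index_enum.
move=> <-; congr (integral _ _ _); apply/seteqP; split => // w _ l.
by rewrite mem_index_enum.
Qed.

End independence.

(** * The Laplace functional of a Poisson process *)

(** The generating function of the Poisson law: [1 - c] will be the probability
    with which a point is discarded. The rate [0] is a separate case because the
    Poisson law is then defined as a Dirac mass. *)
Lemma poisson_gf (R : realType) (r c : R) : 0 <= r -> 0 <= c ->
  (\sum_(k <oo) (c ^+ k)%:E * poisson_prob r 0 [set k] =
   (expR (- ((1 - c) * r)))%:E)%E.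
Proof.
move=> r0 c0; have [->|rn0] := eqVneq r 0.
  rewrite /poisson_prob ltxx mulr0 oppr0 expR0.
  rewrite (nneseriesD1 (n := 0%N))//; last first.
    by move=> k _; rewrite mule_ge0// lee_fin exprn_ge0.
  rewrite expr0 mul1e diracE mem_set// eseries0 ?adde0// => k _ /= k0.
  by rewrite diracE memNset ?mule0//= => k0'; rewrite -k0' in k0.
have {r0 rn0} r0 : 0 < r by rewrite lt_neqAle eq_sym rn0.
transitivity (\sum_(k <oo) (expR (- r))%:E * (((c * r) ^+ k / k`!%:R)%:E))%E.
  apply: eq_eseriesr => k _.
  rewrite /poisson_prob r0 esum_set1; last by rewrite lee_fin poisson_pmf_ge0.
  by rewrite /poisson_pmf r0 -!EFinM; congr EFin; rewrite exprMn; ring.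
rewrite nneseriesZl/=; last first.
  by move=> n _; rewrite lee_fin divr_ge0// exprn_ge0// mulr_ge0// ltW.
rewrite (_ : - ((1 - c) * r) = - r + c * r); last by ring.
rewrite expRD EFinM; congr *%E; rewrite [in RHS]expRE -EFin_lim; last first.
  rewrite /pseries/=; under eq_fun do rewrite mulrC.
  exact: is_cvg_series_exp_coeff.
apply/congr_lim/funext => n/=; rewrite /pseries/= /series/= -sumEFin//.
by under eq_bigr do rewrite mulrC.
Qed.

Section laplace.
Context {R : realType} {d : nat} {disp : measure_display}.
Context {T : measurableType disp} (P : probability T R).
Variables (lambda : R) (N : T -> nat) (X : nat -> T -> vec R d).
Hypothesis lambda0 : 0 <= lambda.
Hypothesis NX : poisson_process P lambda N X.

Lemma measurable_random_prod (f : vec R d -> R) : measurable_fun setT f ->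
  measurable_fun setT (fun w => \prod_(i < N w) f (X i w)).
Proof.
move=> mf; have [mN mX _ _ _] := NX.
apply: (measurable_stopped (f := fun n w => \prod_(i < n) f (X i w)) mN) => n.
apply: measurable_prod => i _; exact: measurableT_comp.
Qed.

Lemma measurable_point_count (A : set (vec R d)) : measurable A ->
  measurable_fun setT (point_count N X A).
Proof.
move=> mA; have [mN mX _ _ _] := NX.
apply: (@measurable_nat_fun R).
rewrite (_ : (fun w => _) = fun w => \sum_(i < N w) (\1_A (X i w) : R)).
  apply: (measurable_stopped (f := fun n w => \sum_(i < n) (\1_A (X i w) : R)) mN) => n.
  apply: measurable_sum => i; apply: measurableT_comp (mX i).
  exact: measurable_indic.
by apply/funext => w; rewrite /point_count natr_sum.
Qed.

(** Grouping the points by level turns the product over the points into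
    [\prod_l (1 - c l) ^+ K l], where [K l] is the number of points of level [l]:
    a product of functions of independent Poisson variables. *)
Lemma laplace_level (m : nat) (lev : vec R d -> 'I_m) (c : 'I_m -> R) :
  (forall l, measurable (lev @^-1` [set l])) -> (forall l, 0 <= c l <= 1) ->
  (\int[P]_w (\prod_(i < N w) (1 - c (lev (X i w))))%:E =
   (expR (- (lambda * fine (\int[lebesgue_tuple R d]_(x in torus) (c (lev x))%:E))))%:E)%E.
Proof.
move=> mlev c01; have [mN mX XS NXpoisson NXindep] := NX.
pose A l := torus `&` lev @^-1` [set l].
have mA l : measurable (A l) by apply: measurableI => //; exact: measurable_torus.
have AS l : A l `<=` torus by move=> x [].
have tA : trivIset setT A.
  apply/trivIsetP => i j _ _ ij; apply/seteqP; split => // x [[_ /= xi] [_ /= xj]].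
  by move/eqP: ij; apply; rewrite -xi -xj.
have AfinE l : (lebesgue_tuple R d (A l))%E \is a fin_num.
  rewrite ge0_fin_numE//; apply: (@le_lt_trans _ _ (lebesgue_tuple R d torus)).
    by apply: le_measure; rewrite ?inE//; exact: measurable_torus.
  by rewrite lebesgue_torus ltry.
pose K l := point_count N X (A l).
have prodE w : \prod_(i < N w) (1 - c (lev (X i w))) = \prod_(l < m) (1 - c l) ^+ K l w.
  rewrite [RHS](eq_bigr (fun l => \prod_(i < N w) (1 - c l) ^+ (X i w \in A l))); last first.
    move=> l _; rewrite /K /point_count.
    by rewrite (big_morph (GRing.exp (1 - c l)) (exprD _) (expr0 _)).
  rewrite exchange_big/=; apply: eq_bigr => i _.
  rewrite (bigD1 (lev (X i w)))//= big1 ?mulr1.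
    by rewrite mem_set ?expr1//; split => //; exact: XS.
  move=> l lX; rewrite memNset ?expr0// => -[_ /= lE].
  by rewrite lE eqxx in lX.
under eq_integral do rewrite prodE.
have c1 l : 0 <= 1 - c l <= 1 by have /andP[] := c01 l; lra.
rewrite (@integral_prod_indep _ _ _ P _ K _ _ (fun l k => (1 - c l) ^+ k)); last 3 first.
- by move=> l; exact: measurable_point_count.
- by move=> k; apply: NXindep.
- by move=> l k; have /andP[? ?] := c1 l; rewrite exprn_ge0// exprn_ile1.
have EK l : (\int[P]_w ((1 - c l) ^+ K l w)%:E =
    (expR (- (c l * (lambda * fine (lebesgue_tuple R d (A l))))))%:E)%E.
  have mK : measurable_fun setT (K l) by exact: measurable_point_count.
  have /andP[cl0 _] := c1 l.
  rewrite (integral_fiber _ mK)//; last 2 first.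
  - apply/measurable_EFinP; apply: (measurableT_comp _ mK).
    by move=> _ Y _; rewrite setTI.
  - by move=> w _; rewrite lee_fin exprn_ge0.
  rewrite [in RHS](_ : c l = 1 - (1 - c l)); last by lra.
  rewrite -poisson_gf//; last by rewrite mulr_ge0// fine_ge0.
  apply: eq_eseriesr => k _; rewrite setTI -NXpoisson//.
  rewrite -integral_cst//; last by rewrite -[X in measurable X]setTI; exact: mK.
  by apply: eq_integral => w; rewrite inE => /= ->.
rewrite (eq_bigr _ (fun l _ => EK l)) prodEFin -expR_sum; congr (expR _)%:E.
rewrite sumrN; congr (- _).
have SE : torus = \big[setU/set0]_(l < m) A l.
  rewrite -bigcup_seq; apply/seteqP; split => x; last by move=> [l _ []].
  by move=> Sx; exists (lev x) => //=; rewrite mem_index_enum.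
have mc := measurable_finite_level c mlev.
rewrite [in RHS]SE ge0_integral_bigsetU//=; last 4 first.
- exact: index_enum_uniq.
- exact: sub_trivIset tA.
- by apply/measurable_EFinP; exact: measurable_funTS.
- by move=> x _; rewrite lee_fin; have /andP[] := c01 (lev x).
have cA l : (\int[lebesgue_tuple R d]_(x in A l) (c (lev x))%:E =
    (c l * fine (lebesgue_tuple R d (A l)))%:E)%E.
  rewrite EFinM fineK// -integral_cst//.
  by apply: eq_integral => x; rewrite inE => -[_ /= ->].
rewrite (eq_bigr _ (fun l _ => cA l)) sumEFin/= mulr_sumr.
by apply: eq_bigr => l _; rewrite mulrCA.
Qed.

Lemma ge0_bounded_integral_fin (f : vec R d -> R) :
  measurable_fun setT f -> (forall x, 0 <= f x <= 1) ->
  (\int[lebesgue_tuple R d]_(x in torus) (f x)%:E)%E \is a fin_num.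
Proof.
move=> mf f01; have mS := @measurable_torus R d.
rewrite ge0_fin_numE; last first.
  by apply: integral_ge0 => x _; rewrite lee_fin; have /andP[] := f01 x.
apply: (@le_lt_trans _ _ (\int[lebesgue_tuple R d]_(x in torus) (cst 1%E x))%E).
  apply: ge0_le_integral => //.
  - by move=> x _; rewrite lee_fin; have /andP[] := f01 x.
  - by apply/measurable_EFinP; exact: measurable_funTS.
  - by move=> x _; rewrite lee_fin; have /andP[] := f01 x.
by rewrite integral_cst// mul1e [X in (X < _)%E]lebesgue_torus ltry.
Qed.

(** The torus has volume [1], so a pointwise error [e] costs at most [e]. *)
Lemma fine_le_integral_torus (f h : vec R d -> R) (e : R) :
  measurable_fun setT f -> measurable_fun setT h ->
  (forall x, 0 <= f x <= 1) -> (forall x, 0 <= h x <= 1) -> 0 <= e ->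
  (forall x, f x <= h x + e) ->
  fine (\int[lebesgue_tuple R d]_(x in torus) (f x)%:E)%E <=
  fine (\int[lebesgue_tuple R d]_(x in torus) (h x)%:E)%E + e.
Proof.
move=> mf mh f01 h01 e0 fh; have mS := @measurable_torus R d.
rewrite -lee_fin EFinD !fineK ?ge0_bounded_integral_fin//.
have mh' : measurable_fun (torus : set (vec R d)) (fun x => (h x)%:E).
  by apply/measurable_EFinP; exact: measurable_funTS.
have -> : (e%:E = \int[lebesgue_tuple R d]_(x in torus) (cst e%:E x))%E.
  by rewrite integral_cst// [X in (_ * X)%E]lebesgue_torus mule1.
have h0 x : torus x -> (0 <= (h x)%:E)%E.
  by move=> _; rewrite lee_fin; have /andP[] := h01 x.
rewrite -ge0_integralD//; apply: ge0_le_integral => //.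
- by move=> x _; rewrite lee_fin; have /andP[] := f01 x.
- by apply/measurable_EFinP; exact: measurable_funTS.
- exact: emeasurable_funD.
- by move=> x _; rewrite /= -EFinD lee_fin.
Qed.

(** Rounding [h] down and up to multiples of [1 / M] squeezes both sides: the
    expectation lies between the values of the right-hand side for
    [\int h + 1 / M] and [\int h - 1 / M]. *)
Lemma poisson_laplace (h : vec R d -> R) :
  measurable_fun setT h -> (forall x, 0 <= h x <= 1) ->
  (\int[P]_w (\prod_(i < N w) (1 - h (X i w)))%:E =
   (expR (- (lambda * fine (\int[lebesgue_tuple R d]_(x in torus) (h x)%:E))))%:E)%E.
Proof.
move=> mh h01; set I := fine _; set E := integral _ _ _.
(* The steps have height [1 / M.+1]; the level [M.+1], reached when [h x = 1],
   makes [M.+2] levels. *)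
pose lev M x : 'I_M.+2 := inord (Num.truncn (M.+1%:R * h x)).
have levE M x : (lev M x : nat) = Num.truncn (M.+1%:R * h x).
  have /andP[h0 h1] := h01 x.
  rewrite /lev inordK// ltnS -(ler_nat R).
  apply: (@le_trans _ _ (M.+1%:R * h x)); last by rewrite ler_piMr.
  by rewrite truncn_le mulr_ge0.
have mlev M l : measurable (lev M @^-1` [set l]).
  rewrite (_ : _ @^-1` _ = (fun x => M.+1%:R * h x) @^-1` `[l%:R, l.+1%:R[%classic).
    rewrite -[X in measurable X]setTI; apply: measurable_funM => //.
  apply/seteqP; split => x /=.
    move=> <-; rewrite levE in_itv/= truncnS_gt andbT truncn_le mulr_ge0//.
    by have /andP[] := h01 x.
  rewrite in_itv/= => lx; apply/val_inj; rewrite /= levE.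
  by apply/eqP; rewrite truncn_eq// mulr_ge0//; have /andP[] := h01 x.
have mlevc M (c : 'I_M.+2 -> R) : measurable_fun setT (fun x => c (lev M x)).
  exact: (measurable_finite_level c (mlev M)).
pose lo M (l : 'I_M.+2) : R := l%:R / M.+1%:R.
(* Without the truncation the rounded value could exceed [1] and would not be a
   probability. *)
pose up M (l : 'I_M.+2) : R := Num.min 1 (l.+1%:R / M.+1%:R).
have lo01 M l : 0 <= lo M l <= 1.
  rewrite /lo divr_ge0//= ler_pdivrMr ?ltr0n// mul1r ler_nat.
  by rewrite -ltnS.
have up01 M l : 0 <= up M l <= 1.
  by rewrite /up ge_min lexx andbT le_min ler01 divr_ge0.
have lo_h M x : lo M (lev M x) <= h x.
  rewrite /lo levE ler_pdivrMr ?ltr0n// mulrC truncn_le mulr_ge0//.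
  by have /andP[] := h01 x.
have h_up M x : h x <= up M (lev M x).
  rewrite /up le_min; have /andP[_ -> /=] := h01 x.
  by rewrite levE ler_pdivlMr ?ltr0n// mulrC ltW// truncnS_gt.
have up_lo M l : up M l <= lo M l + M.+1%:R^-1.
  by rewrite /up /lo ge_min -[l.+1%:R]natr1 mulrDl mul1r lexx orbT.
have le_prod (c f : vec R d -> R) : (forall x, c x <= f x) -> (forall x, f x <= 1) ->
  measurable_fun setT c -> measurable_fun setT f ->
  (\int[P]_w (\prod_(i < N w) (1 - f (X i w)))%:E <=
   \int[P]_w (\prod_(i < N w) (1 - c (X i w)))%:E)%E.
  move=> cf f1 mc mf.
  apply: ge0_le_integral => //.
  - by move=> w _; rewrite lee_fin prodr_ge0// => i _; rewrite subr_ge0.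
  - apply/measurable_EFinP; apply: (measurable_random_prod (f := fun x => 1 - f x)).
    exact: measurable_funB.
  - apply/measurable_EFinP; apply: (measurable_random_prod (f := fun x => 1 - c x)).
    exact: measurable_funB.
  - move=> w _; rewrite lee_fin; apply: ler_prod => i _.
    by rewrite subr_ge0 f1 lerD2l lerN2 cf.
have Eup M : (E <= (expR (- (lambda * (I - M.+1%:R^-1))))%:E)%E.
  apply: le_trans (le_prod _ _ (lo_h M) _ (mlevc _ _) _) _ => //.
    by move=> x; have /andP[] := h01 x.
  rewrite laplace_level// lee_fin ler_expR lerN2 ler_wpM2l// lerBlDr.
  apply: fine_le_integral_torus => //.
  by move=> x; apply: le_trans (h_up M x) (up_lo _ _).
have Elo M : ((expR (- (lambda * (I + M.+1%:R^-1))))%:E <= E)%E.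
  apply: le_trans (le_prod _ _ (h_up M) _ _ (mlevc _ _)); last 2 first.
  - by move=> x; have /andP[] := up01 M (lev M x).
  - by [].
  rewrite laplace_level// lee_fin ler_expR lerN2 ler_wpM2l//.
  apply: fine_le_integral_torus => //.
  by move=> x; apply: le_trans (up_lo _ _) _; rewrite lerD2r.
have Efin : E \is a fin_num.
  by rewrite fin_numE; have := Eup 0%N; have := Elo 0%N; case: (E).
rewrite -(fineK Efin); congr EFin.
have cvh : @harmonic R @ \oo --> 0 := cvg_harmonic.
have cve (s : R) : expR (- (lambda * (I + s * @harmonic R n))) @[n --> \oo] -->
    expR (- (lambda * I)).
  apply: continuous_cvg; first exact: continuous_expR.
  apply: cvgN; apply: cvgMl_tmp; rewrite -[X in _ --> X]addr0.
  apply: cvgD; first exact: cvg_cst.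
  by rewrite -(mulr0 s); exact: cvgMl_tmp.
apply/eqP; rewrite eq_le; apply/andP; split.
  rewrite -(cvg_lim _ (cve (-1)))//; apply: limr_ge; first exact: cvgP (cve _).
  by apply: nearW => n; rewrite mulN1r -lee_fin fineK//; exact: Eup.
rewrite -(cvg_lim _ (cve 1))//; apply: limr_le; first exact: cvgP (cve _).
by apply: nearW => n; rewrite mul1r -lee_fin fineK//; exact: Elo.
Qed.

End laplace.

(** * Averaging over the edges *)

(** The pairs selected by the condition stand for the edges at the vertex
    [0]. *)
Lemma prod_first_row (R : comPzRingType) k (F : nat -> R) :
  \prod_(p : 'I_k * 'I_k) (if ((p.1 : nat) == 0%N) && (0 < p.2)%N then F p.2 else 1) =
  \prod_(i < k.-1) F i.+1.
Proof.
case: k => [|k]; first by rewrite [RHS]big_ord0 big1// => -[[]].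
rewrite -(pair_bigA _ (fun i j : 'I_k.+1 => if ((i : nat) == 0%N) && (0 < j)%N
    then F j else 1))/=.
rewrite big_ord_recl/= [X in _ * X]big1 ?mulr1; last by move=> i _; rewrite big1.
by rewrite big_ord_recl/= mul1r.
Qed.

Section palm_edges.
Context {R : realType} {d : nat} {disp : measure_display}.
Context {T : measurableType disp} (P : probability T R).
Variables (lambda : R) (g : R -> R) (r s : R) (G : random_graph R d T).
Hypotheses (gc : connection_function g) (r0 : 0 < r) (s0 : 0 <= s).
Hypothesis GP : palm_random_connection P lambda g r G.

(** For a point [x] of the torus, this is the probability of an edge longer than
    [s] between [x] and the origin. *)
Definition long_prob (x : vec R d) : R :=
  \1_[set y : vec R d | s < enorm y] x * g (enorm x / r).

Lemma measurable_long_prob : measurable_fun setT long_prob.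
Proof.
apply: measurable_funM; first by apply: measurable_indic; exact: measurable_enorm_gt.
apply: measurable_connection => //.
  by apply: measurable_funM => //; exact: measurable_enorm.
by move=> x; rewrite divr_ge0 ?enorm_ge0// ltW.
Qed.

Lemma long_prob01 x : 0 <= long_prob x <= 1.
Proof.
have [g01 _] := gc.
have /andP[g0 g1] := g01 (enorm x / r) (divr_ge0 (enorm_ge0 x) (ltW r0)).
by rewrite /long_prob indicE mulr_ge0//= mulr_ile1// lern1 leq_b1.
Qed.

Let n_vertices := vertex_count G.

Lemma measurable_vertex_count : measurable_fun setT n_vertices.
Proof.
have [n0 _ [mN _ _ _ _] _] := GP.
rewrite (_ : n_vertices = succn \o (fun w => (vertex_count G w).-1)).
  by apply: measurableT_comp mN => _ Y _; rewrite setTI.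
by apply/funext => w /=; rewrite prednK.
Qed.

Lemma measurable_vertex i : measurable_fun setT (vertex G i).
Proof.
have [_ X0 [_ mX _ _ _] _] := GP.
case: i => [|i]; last exact: mX.
by rewrite (_ : vertex G 0 = cst origin)//; apply/funext => w; exact: X0.
Qed.

Lemma vertex_torus i w : (0 < i < n_vertices w)%N -> torus (vertex G i w).
Proof.
have [_ _ [_ _ XS _ _] _] := GP.
by case: i => // i /= iw; apply: XS; rewrite -ltnS prednK// (leq_ltn_trans _ iw).
Qed.

Lemma measurable_connection_prob i j :
  measurable_fun setT (connection_prob g r G i j).
Proof.
apply: measurable_connection => //.
  by apply: measurable_funM => //; apply: measurable_torus_dist; exact: measurable_vertex.
by move=> w; rewrite divr_ge0 ?torus_dist_ge0// ltW.
Qed.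

Lemma connection_prob01 i j w : 0 <= connection_prob g r G i j w <= 1.
Proof. by have [g01 _] := gc; apply: g01; rewrite divr_ge0 ?torus_dist_ge0// ltW. Qed.

Section fixed_size.
Variable k : nat.

Let pairs := ('I_k * 'I_k)%type.
Let Vk := n_vertices @^-1` [set k].
Let short := [set w | longest_edge G 0 w <= s].

(** A pattern prescribes all edges of a graph on [k] vertices. Only the pairs
    [i < j] carry information; the other entries are forced to be [false], so
    that distinct patterns describe disjoint events. *)
Definition pattern : pred {ffun pairs -> bool} :=
  family (fun (p : pairs) (b : bool) => (p.1 < p.2)%N || ~~ b).

Definition pattern_pos (f : {ffun pairs -> bool}) : set (k.-tuple (vec R d)) :=
  [set x | forall p : pairs, (p.1 : nat) = 0%N -> (0 < p.2)%N -> f p ->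
    enorm (tnth x p.2) <= s].

Definition pattern_event (f : {ffun pairs -> bool}) : set T :=
  [set w | n_vertices w = k /\ pattern_pos f [tuple vertex G i w | i < k]] `&`
  [set w | forall i j : 'I_k, (i < j)%N -> edge G i j w = f (i, j)].

Lemma measurable_pattern_pos f : measurable (pattern_pos f).
Proof.
rewrite (_ : pattern_pos f = \bigcap_(p in [set p : pairs |
    [/\ (p.1 : nat) = 0%N, (0 < p.2)%N & f p]])
    ((@tnth k (vec R d) ^~ p.2) @^-1` (~` [set y | s < enorm y]))).
  apply: fin_bigcap_measurable; first exact: finite_finset.
  move=> p _; rewrite -[X in measurable X]setTI; apply: measurable_tnth => //.
  by apply: measurableC; exact: measurable_enorm_gt.
apply/seteqP; split => x.
  by move=> h p [p1 p2 fp]; apply/negP; rewrite /= -leNgt; exact: h.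
by move=> h p p1 p2 fp; rewrite leNgt; apply/negP; apply: (h p); split.
Qed.

Lemma measurable_pattern_event f : measurable (pattern_event f).
Proof.
have [_ _ _ [mE _ _]] := GP.
apply: measurableI.
  rewrite (_ : [set _ | _] = Vk `&`
      ((fun w => [tuple vertex G i w | i < k]) @^-1` pattern_pos f)).
    apply: measurableI; rewrite -[X in measurable X]setTI.
      exact: measurable_vertex_count.
    have : measurable_fun setT (fun w => [tuple vertex G i w | i < k]).
      apply/measurable_fun_tnthP => i.
      rewrite (_ : _ \o _ = vertex G i); first exact: measurable_vertex.
      by apply/funext => w /=; rewrite tnth_mktuple.
    by apply => //; exact: measurable_pattern_pos.
  by apply/seteqP; split.
rewrite (_ : [set _ | _] = \bigcap_(p in [set p : pairs | (p.1 < p.2)%N])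
    (edge G p.1 p.2 @^-1` [set f p])).
  apply: fin_bigcap_measurable; first exact: finite_finset.
  by move=> p _; rewrite -[X in measurable X]setTI; exact: mE.
apply/seteqP; split => w h; first by move=> [i j]; exact: h.
by move=> i j ij; exact: (h (i, j)).
Qed.

(** Once all edges are prescribed, the absence of long edges at the origin is a
    condition on the positions alone, so the law of the edges gives the
    probability of each piece. *)
Lemma short_patterns :
  short `&` Vk = \bigcup_(f in [set` enum pattern]) pattern_event f.
Proof.
have [n0 X0 _ _] := GP.
apply/seteqP; split => w.
  move=> [/= ws wk].
  exists [ffun p : pairs => (p.1 < p.2)%N && edge G p.1 p.2 w].
    rewrite /= mem_enum; apply/familyP => p; rewrite ffunE unfold_in/=.
    by case: (p.1 < p.2)%N.
  split; last by move=> i j ij; rewrite ffunE/= ij.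
  split => // -[i j] /= i0 j0; rewrite ffunE/= => /andP[ij eij].
  rewrite tnth_mktuple -torus_dist_origin; last first.
    by apply: vertex_torus; rewrite j0 wk ltn_ord.
  rewrite -(X0 w); apply: le_trans ws.
  have jw : (j < vertex_count G w)%N by rewrite [vertex_count _ _]wk.
  rewrite /longest_edge.
  apply: (le_trans _ (le_bigmax_cond _ _ (j := Ordinal jw) _)) => //=.
  by rewrite -lt0n j0 -[0%N]i0.
move=> [f _ [[/= wk fp] fe]]; split => //.
apply: bigmax_le => // j /andP[j0 e0j].
have jk : (j < k)%N by rewrite -wk.
have k0 : (0 < k)%N by rewrite -wk.
rewrite X0 torus_dist_origin; last by apply: vertex_torus; rewrite lt0n j0 /= ltn_ord.
have := fp (Ordinal k0, Ordinal jk); rewrite tnth_mktuple; apply => //=.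
  by rewrite lt0n.
by rewrite -fe//= lt0n.
Qed.

Lemma trivIset_patterns : trivIset [set` enum pattern] pattern_event.
Proof.
apply/trivIsetP => f f' /=; rewrite !mem_enum => /familyP fp /familyP fp' ff'.
apply/seteqP; split => // w [[_ ef] [_ ef']].
apply: (negP ff'); apply/eqP/ffunP => -[i j].
have [ij|ij] := boolP (i < j)%N; first by rewrite -ef// -ef'.
have := fp (i, j); have := fp' (i, j); rewrite !unfold_in/= (negbTE ij)/=.
by case: (f _); case: (f' _).
Qed.

(** The position constraint of [pattern_pos] is absorbed in the factor of an
    edge at the origin, which vanishes when that edge is too long. The sum over
    the patterns then factorises over the pairs. *)
Definition pair_factor w (p : pairs) (b : bool) : R :=
  if (p.1 < p.2)%N then
    if b then connection_prob g r G p.1 p.2 w *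
      (1 - ((p.1 : nat) == 0%N)%:R * \1_[set y : vec R d | s < enorm y] (vertex G p.2 w))
    else 1 - connection_prob g r G p.1 p.2 w
  else 1.

Lemma pair_factor_ge0 w p b : 0 <= pair_factor w p b.
Proof.
rewrite /pair_factor; case: ifP => // _.
have /andP[p0 p1] := connection_prob01 p.1 p.2 w.
case: b; last by rewrite subr_ge0.
rewrite mulr_ge0// subr_ge0 indicE -natrM lern1.
by case: eqP => //= _; rewrite mul1n leq_b1.
Qed.

Lemma measurable_pair_factor p b : measurable_fun setT (fun w => pair_factor w p b).
Proof.
rewrite /pair_factor; case: (p.1 < p.2)%N => //; case: b.
  apply: measurable_funM; first exact: measurable_connection_prob.
  apply: measurable_funB => //; apply: measurable_funM => //.
  apply: measurableT_comp (measurable_vertex _).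
  by apply: measurable_indic; exact: measurable_enorm_gt.
by apply: measurable_funB => //; exact: measurable_connection_prob.
Qed.

Lemma pattern_event_prob f : f \in pattern ->
  P (pattern_event f) = (\int[P]_(w in Vk) (\prod_p pair_factor w p (f p))%:E)%E.
Proof.
move=> /familyP fp; have [_ _ _ [_ _ Pe]] := GP.
rewrite /pattern_event (Pe _ _ (fun i j => f (i, j)) (measurable_pattern_pos f)).
pose W := [set w | pattern_pos f [tuple vertex G i w | i < k]].
rewrite (_ : [set w | _] = Vk `&` W)// integral_mkcondr.
apply: eq_integral => w _; rewrite patchE.
have far0 (p : pairs) : W w -> (p.1 : nat) = 0%N -> (p.1 < p.2)%N -> f p ->
    \1_[set y : vec R d | s < enorm y] (vertex G p.2 w) = 0 :> R.
  move=> Ww p1 p12 fpp; rewrite indicE memNset//= => sX.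
  have := Ww p p1 _ fpp; rewrite tnth_mktuple -p1 => /(_ p12).
  by rewrite leNgt sX.
have [/set_mem Ww|/negP nW] := boolP (w \in W); congr EFin.
  rewrite pair_big_dep/= big_mkcond/=; apply: eq_bigr => p _.
  rewrite /pair_factor -surjective_pairing; case: ifP => // p12.
  case: ifP => // fpp; have [p1|p1] := eqVneq (p.1 : nat) 0%N.
    by rewrite far0// mulr0 subr0 mulr1.
  by rewrite mul0r subr0 mulr1.
(* A violated position constraint makes the factor of that pair vanish. *)
have /existsNP[p] : ~ W w by move=> ?; apply: nW; rewrite inE.
move=> /not_implyP[p1 /not_implyP[p2 /not_implyP[fpp]]].
rewrite tnth_mktuple => /negP; rewrite -ltNge => sX.
rewrite (bigD1 p)//= /pair_factor fpp p1 p2 eqxx indicE mem_set// mulr1 subrr.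
by rewrite mulr0 mul0r.
Qed.

(** Summing an edge indicator over its two values gives [1], except for the
    edges at the origin, where the long edges are missing from the sum. *)
Lemma sum_pair_factor w : n_vertices w = k ->
  \prod_(p : pairs) (\sum_(b : bool | (p.1 < p.2)%N || ~~ b) pair_factor w p b) =
  \prod_(i < (n_vertices w).-1) (1 - long_prob (vertex G i.+1 w)).
Proof.
have [_ X0 _ _] := GP.
move=> wk.
transitivity (\prod_(p : pairs) (if ((p.1 : nat) == 0%N) && (0 < p.2)%N
    then 1 - long_prob (vertex G p.2 w) else 1)).
  apply: eq_bigr => p _; rewrite big_mkcond big_bool/= orbT orbF /pair_factor.
  have [p1|p1] := eqVneq (p.1 : nat) 0%N; last first.
    by case: (p.1 < p.2)%N => /=; ring.
  rewrite p1; case: (ltnP 0 p.2) => p2 /=; last by rewrite add0r.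
  rewrite mul1r /long_prob /connection_prob X0 torus_dist_origin.
    by rewrite mulrBr mulr1 addrC addrA subrK mulrC.
  by apply: vertex_torus; rewrite p2 wk ltn_ord.
by rewrite wk (prod_first_row _ (fun j => 1 - long_prob (vertex G j w))).
Qed.

(** The sum over the patterns of a product over the pairs is the product over
    the pairs of the sums over the two states of an edge. *)
Lemma short_fixed_size :
  P (short `&` Vk) = (\int[P]_(w in Vk)
    (\prod_(i < (n_vertices w).-1) (1 - long_prob (vertex G i.+1 w)))%:E)%E.
Proof.
have mV : measurable Vk.
  by rewrite -[X in measurable X]setTI; exact: measurable_vertex_count.
rewrite short_patterns measure_fin_bigcup//; last 2 first.
- exact: trivIset_patterns.
- by move=> f _; exact: measurable_pattern_event.
rewrite -fsbig_seq ?enum_uniq//.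
transitivity (\sum_(f <- enum pattern)
    \int[P]_(w in Vk) (\prod_p pair_factor w p (f p))%:E)%E.
  by apply: eq_big_seq => f; rewrite mem_enum => fp; exact: pattern_event_prob.
rewrite -ge0_integral_sum//; last 2 first.
- move=> f; apply/measurable_EFinP; apply: measurable_prod => p _.
  by apply: measurable_funTS; exact: measurable_pair_factor.
- by move=> f w _; rewrite lee_fin prodr_ge0// => p _; exact: pair_factor_ge0.
apply: eq_integral => w; rewrite inE => /= wk.
by rewrite -sum_pair_factor// bigA_distr_big_dep sumEFin big_enum.
Qed.

End fixed_size.

(** The law of the edges is given for each number of vertices separately, hence
    the decomposition according to that number. *)
Lemma prob_longest_edge :
  P [set w | longest_edge G 0 w <= s] = (\int[P]_w
    (\prod_(i < (n_vertices w).-1) (1 - long_prob (vertex G i.+1 w)))%:E)%E.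
Proof.
have [_ _ NX _] := GP.
have mV := measurable_vertex_count.
set A := [set w | _].
have AE : A = \bigcup_k (A `&` n_vertices @^-1` [set k]).
  apply/seteqP; split => w; first by move=> Aw; exists (n_vertices w).
  by move=> [k _ []].
have mA k : measurable (A `&` n_vertices @^-1` [set k]).
  rewrite short_patterns; apply: fin_bigcup_measurable; first exact: finite_finset.
  by move=> f _; exact: measurable_pattern_event.
rewrite [in LHS]AE measure_bigcup//; last first.
  apply/trivIsetP => i j _ _ ij; apply/seteqP; split => // w [[_ /= Ki] [_ /= Kj]].
  by move/eqP: ij; apply; rewrite -Ki -Kj.
rewrite (integral_fiber _ mV)//; last 2 first.
- apply/measurable_EFinP.
  apply: (measurable_random_prod NX (f := fun x => 1 - long_prob x)).
  by apply: measurable_funB => //; exact: measurable_long_prob.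
- move=> w _; rewrite lee_fin prodr_ge0// => i _; rewrite subr_ge0.
  by have /andP[] := long_prob01 (vertex G i.+1 w).
under eq_eseriesl do rewrite in_setT.
by apply: eq_eseriesr => k _; rewrite setTI; exact: short_fixed_size.
Qed.

End palm_edges.

(** * Rescaling and asymptotics *)

Section intensity.
Context {R : realType} {d : nat}.
Variables (g : R -> R) (gc : connection_function g).

Let mg : measurable_fun setT (fun x : vec R d => (g (enorm x))%:E).
Proof.
apply/measurable_EFinP; apply: measurable_connection => //.
  exact: measurable_enorm.
by move=> x; exact: enorm_ge0.
Qed.

Let g0 (x : vec R d) : (0 <= (g (enorm x))%:E)%E.
Proof. by rewrite lee_fin; have [/(_ _ (enorm_ge0 x)) /andP[]] := gc. Qed.

Let far (a : R) : set (vec R d) := ~` [set x | enorm x <= a].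

Let inside (r : R) : set (vec R d) := [set z | torus (vscale r z)].

Let measurable_inside r : measurable (inside r).
Proof.
rewrite -[X in measurable X]setTI; apply: measurable_vscale => //.
exact: measurable_torus.
Qed.

Let farE a : far a = [set x | a < enorm x].
Proof.
by apply/seteqP; split => x; rewrite /far /= ltNge => /negP.
Qed.

Lemma connection_tail_ge0 a : (0 <= connection_tail d g a)%E.
Proof. exact: integral_ge0. Qed.

Lemma connection_tail_le_mass a : (connection_tail d g a <= connection_mass d g)%E.
Proof.
apply: ge0_subset_integral => //.
by rewrite -/(far a) farE; exact: measurable_enorm_gt.
Qed.

(** The change of variables [x = r z]. *)
Lemma rescaled_intensity r a : 0 < r ->
  (\int[lebesgue_tuple R d]_(x in torus) (long_prob g r (a * r) x)%:E =
   (r ^+ d)%:E *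
   \int[lebesgue_tuple R d]_(z in far a `&` inside r) (g (enorm z))%:E)%E.
Proof.
move=> r0.
have mh : measurable_fun setT ((fun x : vec R d => (long_prob g r (a * r) x)%:E) \_ torus).
  apply/(measurable_restrictT _ (@measurable_torus R d)).
  by apply/measurable_EFinP; apply: measurable_funTS; exact: measurable_long_prob.
rewrite [LHS]integral_mkcond (lebesgue_tuple_scale r0 mh); last first.
  move=> x; rewrite patchE; case: ifP => // _.
  by rewrite lee_fin; have /andP[] := long_prob01 (a * r) gc r0 x.
congr (_ * _)%E; rewrite [RHS]integral_mkcond; apply: eq_integral => z _.
rewrite !patchE in_setI farE.
have -> : (vscale r z \in torus) = (z \in inside r).
  by apply/idP/idP; rewrite !inE.
case: (z \in inside r); rewrite ?andbF// andbT /long_prob indicE.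
rewrite enorm_vscale ?ltW// [r * _ / r]mulrAC divff ?gt_eqF// mul1r.
have -> : (vscale r z \in [set y | a * r < enorm y]) = (z \in [set y | a < enorm y]).
  by apply/idP/idP; rewrite !inE/= enorm_vscale ?ltW// mulrC ltr_pM2l.
by case: ifP; rewrite ?mul1r ?mul0r.
Qed.

(** After rescaling, the mean number of long edges misses only the part of the
    tail lying outside the rescaled torus, hence outside the ball of radius
    [1 / (2 r)]. *)
Lemma intensity_bounds r a : 0 < r ->
  let J := (\int[lebesgue_tuple R d]_(x in torus) (long_prob g r (a * r) x)%:E)%E in
  (J <= (r ^+ d)%:E * connection_tail d g a)%E /\
  ((r ^+ d)%:E * connection_tail d g a <= J + (r ^+ d)%:E *
    \int[lebesgue_tuple R d]_(x in [set x | ((2 * r)^-1 <= enorm x)%R]) (g (enorm x))%:E)%E.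
Proof.
move=> r0 J; rewrite /J rescaled_intensity//.
have rd0 : (0 <= (r ^+ d)%:E)%E by rewrite lee_fin exprn_ge0// ltW.
have mfar : measurable (far a) by rewrite farE; exact: measurable_enorm_gt.
have mI := measurable_inside r.
split.
  apply: lee_wpmul2l => //; apply: ge0_subset_integral => //.
  - exact: measurableI.
  - exact: measurable_funTS.
rewrite -ge0_muleDr; [|exact: integral_ge0..].
apply: lee_wpmul2l => //.
rewrite /connection_tail -/(far a) -[X in integral _ X](setUIDK _ (inside r)).
have mFI : measurable (far a `&` inside r) by exact: measurableI.
have mFD : measurable (far a `\` inside r) by exact: measurableD.
rewrite (ge0_integral_setU _ mFI mFD)//=; last 2 first.
- exact: measurable_funTS.
- by apply/disj_setPS => x [[_ +] [_]].
apply: leeD2l; apply: ge0_subset_integral => //.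
- exact: measurable_enorm_ge.
- exact: measurable_funTS.
move=> z [_ /enorm_torusC]; rewrite (enorm_vscale _ (ltW r0)) /= => h.
by rewrite /= -[leLHS]mul1r ler_pdivrMr ?mulr_gt0//; lra.
Qed.

End intensity.

Section limit.
Context {R : realType} {d : nat}.
Variables (g : R -> R) (gc : connection_function g).

Lemma rhat_cvg0 (r : nat -> R) (kappa : R) : (0 < d)%N -> 0 < kappa ->
  (forall n, (1 < n)%N -> 0 < r n /\ r n ^+ d = kappa * (ln n%:R / n%:R)) ->
  forall e, 0 < e -> \forall n \near \oo, r n < e.
Proof.
move=> d0 k0 rE e e0.
have lim0 : kappa * (ln n%:R `^ 1 * n%:R `^ (- 1)) @[n --> \oo] --> (0 : R).
  by rewrite -[X in _ --> X](mulr0 kappa); apply: cvgMl_tmp; exact: ln_powR_cvg0.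
have /cvgr0Pnorm_lt /(_ (e ^+ d) (exprn_gt0 _ e0)) := lim0.
apply: filterS2 (nbhs_infty_gt 1%N) => n n1.
have [rn rnd] := rE n n1.
rewrite ger0_norm; last first.
  by rewrite mulr_ge0 ?(ltW k0)// mulr_ge0// powR_ge0.
rewrite powRr1 ?ln_ge0 ?ler1n ?(ltnW n1)// powR_inv1// -rnd.
by rewrite ltr_pXn2r// nnegrE ltW.
Qed.

(** With [b = (c - d) / d] the sequence is a multiple of
    [(ln n)^(1 + b) n^-b]. *)
Lemma boundary_cvg0 (r : nat -> R) (kappa c : R) : (0 < d)%N -> 0 < kappa ->
  d%:R < c ->
  (forall n, (1 < n)%N -> 0 < r n /\ r n ^+ d = kappa * (ln n%:R / n%:R)) ->
  (n%:R * r n ^+ d) * ((2 * r n)^-1 `^ (d%:R - c)) @[n --> \oo] --> (0 : R).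
Proof.
move=> d0 k0 dc rE.
have d0' : 0 < d%:R :> R by rewrite ltr0n.
pose b := (c - d%:R) / d%:R.
have b0 : 0 < b by rewrite divr_gt0 ?subr_gt0.
pose C := kappa `^ (1 + b) * 2 `^ (c - d%:R).
have lim0 : C * (ln n%:R `^ (1 + b) * n%:R `^ (- b)) @[n --> \oo] --> (0 : R).
  rewrite -[X in _ --> X](mulr0 C); apply: cvgMl_tmp; apply: ln_powR_cvg0 => //.
  by rewrite addr_gt0.
apply: cvg_trans lim0; apply: near_eq_cvg; near=> n.
have n1 : (1 < n)%N by near: n; exact: nbhs_infty_gt.
have [rn rnd] := rE n n1.
have n0 : 0 < n%:R :> R by rewrite ltr0n (ltn_trans _ n1).
have ln0 : 0 < ln n%:R :> R by rewrite ln_gt0// ltr1n.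
rewrite -powR_inv1 ?mulr_ge0 ?(ltW rn)// -powRrM mulN1r opprB.
rewrite powRM ?(ltW rn)//.
have -> : r n `^ (c - d%:R) = (kappa * (ln n%:R / n%:R)) `^ b.
  rewrite -rnd -(powR_mulrn _ (ltW rn)) -powRrM; congr (_ `^ _).
  by rewrite /b mulrC divfK// gt_eqF.
rewrite rnd !powRM ?divr_ge0 ?invr_ge0 ?(ltW k0) ?(ltW ln0) ?(ltW n0)//.
have powR1D x : 0 < x -> x `^ (1 + b) = x * x `^ b.
  by move=> x0; rewrite powRD ?powRr1 ?(ltW x0)// (gt_eqF x0) implybT.
rewrite /C !powR1D//.
rewrite -(powR_inv1 (ltW n0)) -powRrM mulN1r powR_inv1 ?(ltW n0)//.
by field; rewrite gt_eqF.
Unshelve. all: by end_near. Qed.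

End limit.

(** * The limit law *)

Theorem proposition2p1 (R : realType) (d : nat) (d_ge2 : (2 <= d)%N)
  (g : R -> R) (g_conn : connection_function g)
  (alpha_gt0 : (0 < connection_mass d g)%E)
  (alpha_lty : (connection_mass d g < +oo)%E)
  (c : R) (c_gtd : d%:R < c)
  (g_littleo : g =o_+oo (fun t : R => t `^ (- c)))
  (gamma : R) (gamma_gt0 : 0 < gamma)
  (rhat : nat -> R)
  (rhat_def : forall n : nat, (1 < n)%N -> 0 < rhat n /\
     rhat n ^+ d = gamma * ln n%:R / (fine (connection_mass d g) * n%:R))
  (beta : R) (a : nat -> R) (a_ge0 : forall n, 0 <= a n)
  (a_lim : ((n%:R * rhat n ^+ d)%:E * connection_tail d g (a n))%E
             @[n --> \oo] --> (expR (- beta))%:E)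
  (disp : nat -> measure_display)
  (T : forall n : nat, measurableType (disp n))
  (Po : forall n : nat, probability (T n) R)
  (Gn : forall n : nat, random_graph R d (T n))
  (Gn_palm : forall n : nat, (1 < n)%N ->
     palm_random_connection (Po n) n%:R g (rhat n) (Gn n)) :
  Po n [set w | longest_edge (Gn n) 0 w <= a n * rhat n]
    @[n --> \oo] --> (expR (- expR (- beta)))%:E.
Proof.
have d0 : (0 < d)%N by apply: leq_trans d_ge2.
set alpha := connection_mass d g in alpha_gt0 alpha_lty rhat_def.
have alpha_fin : alpha \is a fin_num by rewrite ge0_fin_numE// ltW.
have alpha0 : 0 < fine alpha by rewrite fine_gt0// alpha_gt0.
pose kappa := gamma / fine alpha.
have kappa0 : 0 < kappa by rewrite divr_gt0.
have rhatE n : (1 < n)%N -> 0 < rhat n /\ rhat n ^+ d = kappa * (ln n%:R / n%:R).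
  move=> n1; have [r0 ->] := rhat_def n n1; split => //.
  by rewrite /kappa invfM; ring.
pose J n := fine (\int[lebesgue_tuple R d]_(x in torus)
  (long_prob g (rhat n) (a n * rhat n) x)%:E)%E.
have probE n : (1 < n)%N ->
    Po n [set w | longest_edge (Gn n) 0 w <= a n * rhat n] =
    (expR (- (n%:R * J n)))%:E.
  move=> n1; have [r0 _] := rhatE n n1.
  rewrite (prob_longest_edge g_conn r0 _ (Gn_palm n n1)) ?mulr_ge0 ?(ltW r0)//.
  have [_ _ NX _] := Gn_palm n n1.
  apply: (poisson_laplace _ NX) => //; first exact: measurable_long_prob.
  exact: long_prob01.
(* [b n] is the mean number of long edges in the whole space instead of the
   torus, and [err n] bounds the difference for large [n]. *)
pose b n := fine ((n%:R * rhat n ^+ d)%:E * connection_tail d g (a n))%E.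
have b_lim : b n @[n --> \oo] --> expR (- beta) by exact: fine_cvg.
have [K K0 tailK] := connection_tail_power g_conn c_gtd g_littleo.
pose err n := K * (n%:R * rhat n ^+ d * (2 * rhat n)^-1 `^ (d%:R - c)).
have err_lim : err n @[n --> \oo] --> (0 : R).
  rewrite -[X in _ --> X](mulr0 K); apply: cvgMl_tmp.
  exact: (boundary_cvg0 d0 kappa0 c_gtd rhatE).
have tail_near : \forall n \near \oo,
    (\int[lebesgue_tuple R d]_(x in [set x | ((2 * rhat n)^-1 <= enorm x)%R])
      (g (enorm x))%:E <= (K * (2 * rhat n)^-1 `^ (d%:R - c))%:E)%E.
  have [M [_ tailM]] := tailK.
  have M1 : 0 < Num.max M 1 by rewrite lt_max ltr01 orbT.
  have e0 : 0 < (2 * Num.max M 1)^-1 by rewrite invr_gt0 mulr_gt0.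
  apply: filterS2 (rhat_cvg0 d0 kappa0 rhatE e0) (nbhs_infty_gt 1%N) => n rM n1.
  have [r0 _] := rhatE n n1.
  apply: tailM; apply: (@le_lt_trans _ _ (Num.max M 1)); first by rewrite le_max lexx.
  rewrite -[ltRHS]mul1r ltr_pdivlMr ?mulr_gt0//.
  by move: rM; rewrite -[ltRHS]mul1r ltr_pdivlMr ?mulr_gt0//; lra.
have J_lim : n%:R * J n @[n --> \oo] --> expR (- beta).
  have be_lim : b n - err n @[n --> \oo] --> expR (- beta).
    by rewrite -[X in _ --> X]subr0; exact: cvgB.
  apply: (squeeze_cvgr _ be_lim b_lim).
  near=> n.
  have n1 : (1 < n)%N by near: n; exact: nbhs_infty_gt.
  have [r0 _] := rhatE n n1.
  have [Jle Jge] := @intensity_bounds R d g g_conn _ (a n) r0.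
  have Jfin := ge0_bounded_integral_fin
    (@measurable_long_prob R d g _ (a n * rhat n) g_conn r0)
    (@long_prob01 R d g _ (a n * rhat n) g_conn r0).
  have tail_fin : connection_tail d g (a n) \is a fin_num.
    rewrite ge0_fin_numE; first exact: le_lt_trans (connection_tail_le_mass g_conn _) _.
    exact: connection_tail_ge0.
  have tail_le : (\int[lebesgue_tuple R d]_(x in [set x | ((2 * rhat n)^-1 <= enorm x)%R])
      (g (enorm x))%:E <= (K * (2 * rhat n)^-1 `^ (d%:R - c))%:E)%E.
    by near: n.
  have n0 : 0 <= n%:R :> R by [].
  have rd0 : (0 <= (rhat n ^+ d)%:E)%E by rewrite lee_fin exprn_ge0// ltW.
  have {}Jge := le_trans Jge (leeD2l _ (lee_wpmul2l rd0 tail_le)).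
  move: Jle Jge; rewrite -(fineK Jfin) -(fineK tail_fin) -/(J n).
  rewrite -!EFinM -EFinD !lee_fin => Jle Jge.
  rewrite /b -(fineK tail_fin) -EFinM /= -!mulrA; apply/andP; split.
    rewrite lerBlDr; apply: le_trans (ler_wpM2l n0 Jge) _.
    by rewrite le_eqVlt; apply/orP; left; apply/eqP; rewrite /err; ring.
  by rewrite ler_wpM2l.
apply: (@cvg_trans _ ((expR (- (n%:R * J n)))%:E @[n --> \oo])).
  apply: near_eq_cvg; near=> n; rewrite probE//; near: n; exact: nbhs_infty_gt.
apply: cvg_EFin; first exact: nearW.
apply: continuous_cvg; first exact: continuous_expR.
exact: cvgN.
Unshelve. all: by end_near. Qed.
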